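(* Let $A$ be a finite set, let $S_1$ be the set of Arrow's single-peaked domains on $A$ and let $S_2$ be the set of single-dipped domains on $A$. The elements of $S_1$ are in one-to-one correspondence with the elements of $S_2$.
   Context: A set $D$ of linear orders on a finite set $A$ is a Condorcet domain if there are no three orders in $D$ and distinct $a_1,a_2,a_3\in A$ such that the three orders rank these elements as $a_1\succ a_2\succ a_3$, $a_2\succ a_3\succ a_1$, $a_3\succ a_1\succ a_2$ respectively. An Arrow's single-peaked domain is a Condorcet domain $D$ such that every triple (3-element subset) $T\subseteq A$ has a ''never-bottom'' element, i.e. an element of $T$ which no order of $D$ ranks last among the elements of $T$. A single-dipped domain is a Condorcet domain $D$ such that every triple $T\subseteq A$ has a ''never-top'' element, i.e. an element of $T$ which no order of $D$ ranks first among the elements of $T$. *)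

(* Defs.v *)
From HB Require Import structures.
From mathcomp Require Import all_boot.

Set Implicit Arguments.
Unset Strict Implicit.
Unset Printing Implicit Defensive.

(* A linear order is encoded by its strict part: the set of pairs (x, y) such
   that x is ranked strictly above y. *)
Definition is_linear_order (A : finType) (R : {set A * A}) : bool :=
  [&& [forall x, (x, x) \notin R],
      [forall x, forall y, forall z,
         ((x, y) \in R) && ((y, z) \in R) ==> ((x, z) \in R)]
    & [forall x, forall y, (x != y) ==> ((x, y) \in R) || ((y, x) \in R)]].

Record linear_order (A : finType) := LinearOrder {
  lo_set : {set A * A};
  lo_setP : is_linear_order lo_set
}.

HB.instance Definition _ (A : finType) := [isSub for @lo_set A].
HB.instance Definition _ (A : finType) := [Finite of linear_order A by <:].

Definition prefers (A : finType) (P : linear_order A) : rel A :=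
  fun x y => (x, y) \in lo_set P.

Definition domain (A : finType) := {set linear_order A}.

Definition ranks3 (A : finType) (P : linear_order A) (x y z : A) : bool :=
  prefers P x y && prefers P y z.

Definition condorcet (A : finType) (D : domain A) : bool :=
  ~~ [exists P1 in D, exists P2 in D, exists P3 in D,
       exists a1, exists a2, exists a3,
         [&& uniq [:: a1; a2; a3], ranks3 P1 a1 a2 a3,
             ranks3 P2 a2 a3 a1 & ranks3 P3 a3 a1 a2]].

Definition ranks_first (A : finType) (P : linear_order A) (T : {set A})
    (x : A) : bool :=
  (x \in T) && [forall y in T, (y != x) ==> prefers P x y].

Definition ranks_last (A : finType) (P : linear_order A) (T : {set A})
    (x : A) : bool :=
  (x \in T) && [forall y in T, (y != x) ==> prefers P y x].

Definition never_top (A : finType) (D : domain A) (T : {set A}) (x : A) : bool :=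
  (x \in T) && [forall P in D, ~~ ranks_first P T x].

Definition never_bottom (A : finType) (D : domain A) (T : {set A})
    (x : A) : bool :=
  (x \in T) && [forall P in D, ~~ ranks_last P T x].

Definition arrow_single_peaked (A : finType) (D : domain A) : bool :=
  condorcet D &&
  [forall T : {set A}, (#|T| == 3) ==> [exists x, never_bottom D T x]].

Definition single_dipped (A : finType) (D : domain A) : bool :=
  condorcet D &&
  [forall T : {set A}, (#|T| == 3) ==> [exists x, never_top D T x]].

Definition S1 (A : finType) : {set domain A} :=
  [set D | arrow_single_peaked D].

Definition S2 (A : finType) : {set domain A} :=
  [set D | single_dipped D].

(* Main.v *)
Require Import Defs.
From mathcomp Require Import all_boot.

(** Reversing every order of a domain is an involution on domains. An element
    is ranked last by an order exactly when the reversed order ranks it first,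
    so a never-bottom element of a domain is a never-top element of the
    reversed one ([never_top_rev]). The Condorcet condition is invariant
    ([condorcet_rev]): reversing the three orders of a cyclic pattern on
    (a1, a2, a3) gives a cyclic pattern on (a3, a2, a1). So a domain lies in
    [S1] exactly when its reverse lies in [S2], and the involution restricts
    to a bijection whose inverse is again reversal. *)

Lemma rev_subproof (A : finType) (P : linear_order A) :
  is_linear_order [set p | prefers P p.2 p.1].
Proof.
case: P => R; rewrite /prefers /= => /and3P[irr tr tot]; apply/and3P; split.
- by apply/forallP => x; rewrite inE; apply: (forallP irr).
- apply/forallP => x; apply/forallP => y; apply/forallP => z; rewrite !inE /=.
  by rewrite andbC; move/forallP/(_ z)/forallP/(_ y)/forallP/(_ x): tr.
- apply/forallP => x; apply/forallP => y; rewrite !inE /= orbC.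
  by move/forallP/(_ x)/forallP/(_ y): tot.
Qed.

Definition rev_order (A : finType) (P : linear_order A) : linear_order A :=
  LinearOrder (rev_subproof A P).

Lemma prefers_rev (A : finType) (P : linear_order A) x y :
  prefers (rev_order A P) x y = prefers P y x.
Proof. by rewrite {1}/prefers inE. Qed.

Lemma rev_orderK (A : finType) : involutive (rev_order A).
Proof.
move=> P; apply: val_inj; apply/setP => -[x y].
exact: etrans (prefers_rev A _ x y) (prefers_rev A P y x).
Qed.

(** The image of a domain under reversal, written as a preimage: the two agree
    as reversal is an involution, and membership then unfolds directly. *)
Definition rev_domain (A : finType) (D : domain A) : domain A :=
  [set P | rev_order A P \in D].

Lemma rev_domainK (A : finType) : involutive (rev_domain A).
Proof. by move=> D; apply/setP => P; rewrite !inE rev_orderK. Qed.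

Lemma ranks3_rev (A : finType) (P : linear_order A) x y z :
  ranks3 (rev_order A P) x y z = ranks3 P z y x.
Proof. by rewrite /ranks3 !prefers_rev andbC. Qed.

Lemma ranks_first_rev (A : finType) (P : linear_order A) T x :
  ranks_first (rev_order A P) T x = ranks_last P T x.
Proof.
by congr (_ && _); apply: eq_forallb => y; rewrite prefers_rev.
Qed.

(** The pointwise exchange of first and last lifts to domains because reversal
    is onto: every order of either domain is the reverse of one of the other. *)
Lemma never_top_rev (A : finType) (D : domain A) T x :
  never_top (rev_domain A D) T x = never_bottom D T x.
Proof.
congr (_ && _); apply/forall_inP/forall_inP => nD P PD.
- by rewrite -ranks_first_rev; apply: nD; rewrite inE rev_orderK.
- rewrite -(rev_orderK A P) ranks_first_rev; apply: nD.
  by rewrite inE in PD.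
Qed.

Lemma condorcet_rev (A : finType) (D : domain A) :
  condorcet (rev_domain A D) = condorcet D.
Proof.
have cyc E : condorcet E -> condorcet (rev_domain A E).
  apply: contra => /exists_inP[P1 P1E] /exists_inP[P2 P2E] /exists_inP[P3 P3E].
  case/existsP=> a1 /existsP[a2 /existsP[a3 /and4P[Ua r1 r2 r3]]].
  rewrite !inE in P1E P2E P3E.
  (* Read from a3 to a1, the reversed second and third orders trade places
     in the cyclic pattern. *)
  apply/exists_inP; exists (rev_order A P1) => //.
  apply/exists_inP; exists (rev_order A P3) => //.
  apply/exists_inP; exists (rev_order A P2) => //.
  apply/existsP; exists a3; apply/existsP; exists a2; apply/existsP; exists a1.
  by rewrite !ranks3_rev r1 r2 r3 -(rev_uniq [:: a3; a2; a1]) Ua.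
by apply/idP/idP => [/cyc|/cyc //]; rewrite rev_domainK.
Qed.

Lemma rev_domain_S2 (A : finType) (D : domain A) :
  (rev_domain A D \in S2 A) = (D \in S1 A).
Proof.
rewrite !inE /single_dipped condorcet_rev; congr (_ && _).
apply: eq_forallb => T; congr (_ ==> _).
by apply: eq_existsb => x; rewrite never_top_rev.
Qed.

Lemma rev_domain_S1 (A : finType) (D : domain A) :
  (rev_domain A D \in S1 A) = (D \in S2 A).
Proof. by rewrite -rev_domain_S2 rev_domainK. Qed.

Theorem theorem8p2 (A : finType) :
  exists f : {D : domain A | D \in S1 A} -> {D : domain A | D \in S2 A},
    bijective f.
Proof.
have to2 (u : {D : domain A | D \in S1 A}) : rev_domain A (val u) \in S2 A.
  by rewrite rev_domain_S2; apply: valP.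
have to1 (u : {D : domain A | D \in S2 A}) : rev_domain A (val u) \in S1 A.
  by rewrite rev_domain_S1; apply: valP.
exists (fun u => exist (fun D => D \in S2 A) _ (to2 u)).
exists (fun u => exist (fun D => D \in S1 A) _ (to1 u)) => u.
- by apply: val_inj; apply: rev_domainK.
- by apply: val_inj; apply: rev_domainK.
Qed.
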